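(* Let $n\ge 1$ be an integer, let $x_i\ge 0$, $a_i>0$, $\mu_i>0$ be real numbers for $i=1,\dots,n$, let $p>1$ be real and let $q$ be defined by $\frac1p+\frac1q=1$. Put $S=\sum_{j=1}^n \mu_j^{\frac1{p-1}}a_j^q$. If $p\ge 2$, then $$\sum_{i=1}^n\frac{x_i^p}{\mu_i}\ \ge\ \frac{\left(\sum_{i=1}^n a_ix_i\right)^p}{S^{\,p-1}}+\frac{1}{S^{\,p}}\sum_{i=1}^n \mu_i^{\frac1{p-1}}a_i^q\left|\left(\frac1{a_i\mu_i}\right)^{\frac1{p-1}}S\,x_i-\sum_{j=1}^n a_jx_j\right|^p .$$ If $1<p\le 2$, then the reverse inequality holds: $$\sum_{i=1}^n\frac{x_i^p}{\mu_i}\ \le\ \frac{\left(\sum_{i=1}^n a_ix_i\right)^p}{S^{\,p-1}}+\frac{1}{S^{\,p}}\sum_{i=1}^n \mu_i^{\frac1{p-1}}a_i^q\left|\left(\frac1{a_i\mu_i}\right)^{\frac1{p-1}}S\,x_i-\sum_{j=1}^n a_jx_j\right|^p .$$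
   Context: All powers are real powers of nonnegative real numbers. *)

(* Defs.v *)
From mathcomp Require Import all_boot all_order all_algebra.
From mathcomp Require Import reals exp.
Set Implicit Arguments.
Unset Strict Implicit.
Unset Printing Implicit Defensive.

(* Real powers are [powR] (a `^ x): every base below is nonnegative, and
   0 `^ x = 0 whenever x != 0. *)

(* Main.v *)
Require Import Defs.
From mathcomp Require Import all_boot all_order all_algebra.
From mathcomp Require Import reals exp.
From mathcomp Require Import ring lra.
Import Order.TTheory GRing.Theory Num.Theory.
Local Open Scope ring_scope.

(** The two inequalities say that [t `^ p] is superquadratic on the nonnegative
reals when [p >= 2], and subquadratic when [1 < p <= 2].

Put [w i = mu i `^ (1/(p-1)) * a i `^ q] and
[y i = (1/(a i * mu i)) `^ (1/(p-1)) * x i].  Since [q = 1 + 1/(p-1)], one has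
[a i * x i = w i * y i] and [x i `^ p / mu i = w i * y i `^ p].  Let [S] be the
total weight and [m] the weighted mean of the [y i].  After division by the
powers of [S], the claim compares the weighted sum of the [y i `^ p] with
[S * m `^ p] plus the weighted sum of the [`|y i - m| `^ p].  Nothing changes
when the terms [p * m `^ (p-1) * (y i - m)] are added, because their weighted
sum is zero; the difference of the two sides is then the weighted sum of the
[superquadratic_gap p (y i) m] (lemma [sum_superquadratic_gap]), and it
suffices to know the sign of each gap.

For that sign put [s = p - 1] and split [y `^ p = m * y `^ s + (y - m) * y `^ s].
The first term is compared with the tangent of [t `^ s] at [m], which is
Bernoulli's inequality for [y / m]; the second is compared through the
super- or subadditivity of [t `^ s].  Both comparisons go one way for [s >= 1]
and the other way for [0 < s <= 1]; this is why the inequality turns around at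
[p = 2].  No calculus is needed: Bernoulli's inequality comes from Young's
inequality, and the range [0 < s <= 1] from the range [s >= 1] applied to the
inverse function [t `^ (1/s)]. *)

(** Young's inequality for the product of [z] and [1], with exponent [s] and its
conjugate [s / (s - 1)]; only [s = 1], which has no finite conjugate, is
separate. *)
Lemma bernoulli_powR_ge1 (R : realType) (z s : R) :
  0 <= z -> 1 <= s -> 1 + s * (z - 1) <= z `^ s.
Proof.
move=> z0; rewrite le_eqVlt => /predU1P[<-|s1].
  by rewrite powRr1 // mul1r addrCA subrr addr0.
have s0 : 0 < s by lra.
have conj_s : s^-1 + (s / (s - 1))^-1 = 1 by field; apply/andP; split; lra.
have c0 : 0 < s / (s - 1) by apply: divr_gt0; lra.
have := @conjugate_powR R z 1 s (s / (s - 1)) z0 ler01 s0 c0 conj_s.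
rewrite powR1 mulr1 => young.
have -> : 1 + s * (z - 1) = s * (z - 1 / (s / (s - 1))).
  by field; apply/andP; split; lra.
by rewrite mulrC -ler_pdivlMr // lerBlDr.
Qed.

(** The inverse function of a power with exponent at most [1] has exponent at
least [1], so this is [bernoulli_powR_ge1] for [z `^ s] and [s^-1]. *)
Lemma bernoulli_powR_le1 (R : realType) (z s : R) :
  0 <= z -> 0 < s <= 1 -> z `^ s <= 1 + s * (z - 1).
Proof.
move=> z0 /andP[s0 s1].
have := @bernoulli_powR_ge1 R (z `^ s) s^-1 (powR_ge0 _ _).
rewrite -powRrM mulfV ?gt_eqF // powRr1 // invf_ge1 // => /(_ s1).
rewrite -(ler_pM2l s0) mulrDr mulrA mulfV ?gt_eqF //; lra.
Qed.

(** Write each power as [t * t `^ (s - 1)]; the second factor is nondecreasing,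
so it is at most its value at [u + v]. *)
Lemma powR_superadditive (R : realType) (u v s : R) :
  0 <= u -> 0 <= v -> 1 <= s -> u `^ s + v `^ s <= (u + v) `^ s.
Proof.
move=> u0 v0 s1; have s0 : 0 < s by lra.
have uv0 : 0 <= u + v by exact: addr_ge0.
rewrite -!(@mulr_powRB1 _ _ s) // mulrDl.
by apply: lerD; apply: ler_wpM2l => //; apply: ge0_ler_powR;
  rewrite ?nnegrE //; lra.
Qed.

(** Superadditivity of the inverse function, at the points [u `^ s] and
[v `^ s]. *)
Lemma powR_subadditive (R : realType) (u v s : R) :
  0 <= u -> 0 <= v -> 0 < s <= 1 -> (u + v) `^ s <= u `^ s + v `^ s.
Proof.
move=> u0 v0 /andP[s0 s1].
have := @powR_superadditive R (u `^ s) (v `^ s) s^-1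
  (powR_ge0 _ _) (powR_ge0 _ _).
rewrite -!powRrM mulfV ?gt_eqF // !powRr1 // invf_ge1 // => /(_ s1) le_uv.
have := @ge0_ler_powR R s (ltW s0) _ _ _ _ le_uv.
rewrite -powRrM mulVf ?gt_eqF // powRr1 ?addr_ge0 ?powR_ge0 //.
by apply; rewrite nnegrE ?addr_ge0 ?powR_ge0.
Qed.

(** A function [f] on the nonnegative reals is superquadratic when
[f y >= f m + C * (y - m) + f `|y - m|] with [C] depending on [m] only; here
[f] is the [p]-th power and [C] its derivative at [m]. *)
Definition superquadratic_gap {R : realType} (p y m : R) : R :=
  y `^ p - m `^ p - p * m `^ (p - 1) * (y - m) - `|y - m| `^ p.

(** The summands isolate the two independent causes of the sign: the Bernoulli
defect of [y / m], and the defect of additivity of the power [p - 1] on the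
segment between [m] and [y]. *)
Lemma superquadratic_gapE (R : realType) (p y m : R) :
  1 < p -> 0 <= y -> 0 <= m ->
  superquadratic_gap p y m =
    m * m `^ (p - 1) * ((y / m) `^ (p - 1) - (1 + (p - 1) * (y / m - 1)))
    + ((y - m) * (y `^ (p - 1) - m `^ (p - 1)) - `|y - m| * `|y - m| `^ (p - 1)).
Proof.
move=> p1 y0 m0; have p0 : 0 < p by lra.
have -> : m * m `^ (p - 1) * ((y / m) `^ (p - 1) - (1 + (p - 1) * (y / m - 1)))
    = m * y `^ (p - 1) - m * m `^ (p - 1) - (p - 1) * m `^ (p - 1) * (y - m).
  (* At m = 0 the quotient y / m is a default value, but every term carries a
     vanishing factor. *)
  have [->|m_neq0] := eqVneq m 0; first by rewrite powR0; [ring | lra].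
  have -> : y `^ (p - 1) = (y / m) `^ (p - 1) * m `^ (p - 1).
    by rewrite -powRM ?divr_ge0 // divfK.
  by field.
by rewrite /superquadratic_gap -!(@mulr_powRB1 _ _ p) //; ring.
Qed.

Lemma superquadratic_gap_ge0 (R : realType) (p y m : R) :
  2 <= p -> 0 <= y -> 0 <= m -> 0 <= superquadratic_gap p y m.
Proof.
move=> p2 y0 m0; rewrite superquadratic_gapE //; last by lra.
have s1 : 1 <= p - 1 by lra.
apply: addr_ge0.
  rewrite mulr_ge0 ?mulr_ge0 ?powR_ge0 // subr_ge0.
  by apply: bernoulli_powR_ge1; rewrite ?divr_ge0.
(* The larger of y and m is the sum of the smaller one and their distance. *)
rewrite subr_ge0; case: (lerP m y) => [le_my|lt_ym].
  rewrite ler_wpM2l ?subr_ge0 //.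
  rewrite lerBrDr -{2}(subrK m y); apply: powR_superadditive; lra.
rewrite -[X in _ <= X]mulrNN !opprB.
apply: ler_wpM2l; first lra.
rewrite lerBrDr -{2}(subrK y m); apply: powR_superadditive; lra.
Qed.

Lemma superquadratic_gap_le0 (R : realType) (p y m : R) :
  1 < p <= 2 -> 0 <= y -> 0 <= m -> superquadratic_gap p y m <= 0.
Proof.
move=> /andP[p1 p2] y0 m0; rewrite superquadratic_gapE //.
have s1 : 0 < p - 1 <= 1 by apply/andP; split; lra.
rewrite -oppr_ge0 opprD; apply: addr_ge0.
  rewrite -mulrN mulr_ge0 ?mulr_ge0 ?powR_ge0 // oppr_ge0 subr_le0.
  by apply: bernoulli_powR_le1; rewrite ?divr_ge0.
rewrite oppr_ge0 subr_le0; case: (lerP m y) => [le_my|lt_ym].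
  rewrite ler_wpM2l ?subr_ge0 //.
  by rewrite lerBlDr -{1}(subrK m y); apply: powR_subadditive => //; lra.
rewrite -[X in X <= _]mulrNN !opprB.
apply: ler_wpM2l; first lra.
by rewrite lerBlDr -{1}(subrK y m); apply: powR_subadditive => //; lra.
Qed.

(** With [m = T / S] the weighted mean, [T `^ p / S `^ (p - 1)] is [S * m `^ p]
and [`|S * y i - T| `^ p] is [S `^ p * `|y i - m| `^ p]; the linear terms of the
gaps cancel because [m] is the mean. *)
Lemma sum_superquadratic_gap
    (R : realType) (I : finType) (w y : I -> R) (p : R) :
  (forall i, 0 <= w i) -> (forall i, 0 <= y i) ->
  let S := \sum_i w i in
  let T := \sum_i w i * y i in
  0 < S ->
  \sum_i w i * y i `^ p
    - (T `^ p / S `^ (p - 1)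
       + 1 / S `^ p * \sum_i w i * `|S * y i - T| `^ p)
  = \sum_i w i * superquadratic_gap p (y i) (T / S).
Proof.
move=> w0 y0 S T S0; set m := T / S.
have m0 : 0 <= m.
  by apply: divr_ge0; apply: sumr_ge0 => i _ //; rewrite mulr_ge0.
have Sp0 : 0 < S `^ p by exact: powR_gt0.
have Sp'0 : 0 < S `^ (p - 1) by exact: powR_gt0.
have TE : T = S * m by rewrite /m mulrC divfK ?gt_eqF.
have Sneq0 : S != 0 by rewrite gt_eqF.
have -> : T `^ p / S `^ (p - 1) = S * m `^ p.
  rewrite TE powRM ?(ltW S0) // powRB ?Sneq0 ?implybT // powRr1 ?(ltW S0) //.
  by field; rewrite Sneq0 gt_eqF.
have -> : 1 / S `^ p * \sum_i w i * `|S * y i - T| `^ p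
    = \sum_i w i * `|y i - m| `^ p.
  rewrite mulr_sumr; apply: eq_bigr => i _.
  rewrite TE -mulrBr normrM (gtr0_norm S0) powRM ?(ltW S0) //.
  by field; rewrite gt_eqF.
have centred : \sum_i w i * (y i - m) = 0.
  under eq_bigr => i _ do rewrite mulrBr.
  by rewrite sumrB -mulr_suml -/S -/T -TE subrr.
have -> : \sum_i w i * superquadratic_gap p (y i) m =
    \sum_i w i * y i `^ p - (\sum_i w i) * m `^ p
    - p * m `^ (p - 1) * (\sum_i w i * (y i - m))
    - \sum_i w i * `|y i - m| `^ p.
  rewrite mulr_suml mulr_sumr -!sumrB; apply: eq_bigr => i _.
  by rewrite /superquadratic_gap; ring.
by rewrite centred -/S; ring.
Qed.

Theorem theorem3 (R : realType) (n : nat) (x a mu : 'I_n -> R) (p q : R)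
    (hn : (1 <= n)%N)
    (hx : forall i, 0 <= x i)
    (ha : forall i, 0 < a i)
    (hmu : forall i, 0 < mu i)
    (hp : 1 < p)
    (hq : 1 / p + 1 / q = 1) :
  let S := \sum_(j < n) (mu j `^ (1 / (p - 1)) * a j `^ q) in
  (2 <= p ->
     \sum_(i < n) (x i `^ p / mu i) >=
       (\sum_(i < n) (a i * x i)) `^ p / S `^ (p - 1)
       + 1 / S `^ p *
         \sum_(i < n) (mu i `^ (1 / (p - 1)) * a i `^ q *
           `| (1 / (a i * mu i)) `^ (1 / (p - 1)) * S * x i
              - \sum_(j < n) (a j * x j) | `^ p))
  /\
  (p <= 2 ->
     \sum_(i < n) (x i `^ p / mu i) <=
       (\sum_(i < n) (a i * x i)) `^ p / S `^ (p - 1)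
       + 1 / S `^ p *
         \sum_(i < n) (mu i `^ (1 / (p - 1)) * a i `^ q *
           `| (1 / (a i * mu i)) `^ (1 / (p - 1)) * S * x i
              - \sum_(j < n) (a j * x j) | `^ p)).
Proof.
have s0 : 0 < p - 1 by lra.
have p0 : 0 < p by lra.
(* The conjugate exponent, in the form that splits off the factor a i. *)
have qE : q = 1 + 1 / (p - 1).
  have -> : q = (1 - 1 / p)^-1 by rewrite -[LHS]invrK -(div1r q); congr _^-1; lra.
  by field; rewrite ?gt_eqF //=; lra.
set s := p - 1 in s0 qE *; set r := 1 / s in qE *.
have rs : r * s = 1 by rewrite /r div1r mulVf ?gt_eqF.
move=> S.
pose w i := mu i `^ r * a i `^ q.
pose y i := (1 / (a i * mu i)) `^ r * x i.
have w0 i : 0 < w i by rewrite mulr_gt0 // powR_gt0.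
have y0 i : 0 <= y i by rewrite mulr_ge0 // powR_ge0.
have wyE i : a i * x i = w i * y i.
  have -> : w i = (a i * mu i) `^ r * a i.
    rewrite /w qE powRD; last by rewrite (gt_eqF (ha i)) implybT.
    by rewrite (powRr1 (ltW (ha i))) powRM ?ltW //; ring.
  rewrite /y div1r -powR_inv1 ?mulr_ge0 ?ltW //.
  by rewrite -powRrM mulN1r powRN; field; rewrite gt_eqF // powR_gt0 ?mulr_gt0.
have wypE i : x i `^ p / mu i = w i * y i `^ p.
  have -> : y i `^ p = y i * ((a i * mu i)^-1 * x i `^ s).
    rewrite -(@mulr_powRB1 _ _ p) // -/s /y powRM ?powR_ge0 //.
    by rewrite -powRrM rs powRr1 ?div1r // invr_ge0 mulr_ge0 ?ltW.
  rewrite mulrA -wyE -(@mulr_powRB1 _ _ p) // -/s.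
  by field; rewrite !gt_eqF.
have S0 : 0 < S.
  rewrite /S (bigD1 (Ordinal hn)) //=; apply: ltr_pwDl; first exact: w0.
  by apply: sumr_ge0 => i _; exact: ltW (w0 i).
pose T := \sum_(i < n) w i * y i.
have m0 : 0 <= T / S.
  rewrite divr_ge0 ?(ltW S0) //; apply: sumr_ge0 => i _.
  exact: mulr_ge0 (ltW (w0 i)) (y0 i).
have gapE : \sum_(i < n) w i * y i `^ p
    - (T `^ p / S `^ s + 1 / S `^ p * \sum_(i < n) w i * `|S * y i - T| `^ p)
    = \sum_(i < n) w i * superquadratic_gap p (y i) (T / S).
  exact: sum_superquadratic_gap (fun i => ltW (w0 i)) y0 S0.
have -> : \sum_(i < n) x i `^ p / mu i = \sum_(i < n) w i * y i `^ p.
  exact: eq_bigr.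
have -> : \sum_(j < n) a j * x j = T by exact: eq_bigr.
have -> : \sum_(i < n) mu i `^ r * a i `^ q *
      `|(1 / (a i * mu i)) `^ r * S * x i - T| `^ p
    = \sum_(i < n) w i * `|S * y i - T| `^ p.
  by apply: eq_bigr => i _; congr (_ * `|_ - _| `^ _); rewrite /y; ring.
split => p2.
  rewrite -subr_ge0 gapE.
  apply: sumr_ge0 => i _; apply: mulr_ge0; first exact: ltW (w0 i).
  exact: superquadratic_gap_ge0.
rewrite -subr_le0 gapE.
apply: sumr_le0 => i _; apply: mulr_ge0_le0; first exact: ltW (w0 i).
by apply: superquadratic_gap_le0; rewrite ?hp.
Qed.
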